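(* For every $k\ge 0$, the language $\bigcap_{i=0}^k L(M_{i,k})$ is nonempty and the minimum length of a word in $\bigcap_{i=0}^k L(M_{i,k})$ is $2^k$.
   Context: For $i,k\ge0$, $M_{i,k}$ is the DFA with states $Q=\{q_0,q_1,q^*\}$ over the alphabet $\{0,1,\dots,k\}$, initial state $q_0$, and transition function $\delta_{i,k}$ equal to the restriction to $Q\times\{0,\dots,k\}$ of $\delta_i\colon Q\times\mathbb N\to Q$ defined as follows. For $i=0$: $\delta_0(q_0,j)=q_1$ if $j=0$ and $q^*$ otherwise; $\delta_0(q_1,j)=q_1$ if $j\ne0$ and $q^*$ otherwise; $\delta_0(q^*,j)=q^*$. For $i\ge1$: $\delta_i(q_0,j)=q_0$ if $j>i$, $q_1$ if $j<i$, $q^*$ if $j=i$; $\delta_i(q_1,j)=q_0$ if $j=i$, $q_1$ if $j>i$, $q^*$ if $j<i$; $\delta_i(q^*,j)=q^*$. The accepting set of $M_{0,k}$ is $\{q_1\}$ and that of $M_{i,k}$ for $i\ge1$ is $\{q_0\}$. $L(M)$ is the set of words $w$ with $\delta(q_0,w)$ accepting (transition function extended to words). *)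

(* Defs.v *)
From HB Require Import structures.
From mathcomp Require Import all_boot.

Set Implicit Arguments.
Unset Strict Implicit.
Unset Printing Implicit Defensive.

Record dfa (char : finType) := Dfa {
  dfa_state : finType;
  dfa_init : dfa_state;
  dfa_trans : dfa_state -> char -> dfa_state;
  dfa_accept : {set dfa_state} }.

Definition dfa_run (char : finType) (M : dfa char) (q : dfa_state M)
    (w : seq char) : dfa_state M := foldl (@dfa_trans _ M) q w.

Definition dfa_lang (char : finType) (M : dfa char) : pred (seq char) :=
  [pred w | dfa_run (dfa_init M) w \in dfa_accept M].

Inductive Q := q0 | q1 | qstar.

(* Encoding of [Q] in [option bool], used only to make [Q] a [finType]. *)
Definition Q_code (q : Q) : option bool :=
  match q with q0 => Some false | q1 => Some true | qstar => None end.

Definition Q_decode (o : option bool) : Q :=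
  match o with Some false => q0 | Some true => q1 | None => qstar end.

Lemma Q_codeK : cancel Q_code Q_decode.
Proof. by case. Qed.

HB.instance Definition _ := Countable.copy Q (can_type Q_codeK).
HB.instance Definition _ : isFinite Q := CanIsFinite Q_codeK.

Definition delta (i : nat) (q : Q) (j : nat) : Q :=
  if i == 0 then
    match q with
    | q0 => if j == 0 then q1 else qstar
    | q1 => if j != 0 then q1 else qstar
    | qstar => qstar
    end
  else
    match q with
    | q0 => if i < j then q0 else if j < i then q1 else qstar
    | q1 => if j == i then q0 else if i < j then q1 else qstar
    | qstar => qstar
    end.

(* The alphabet {0, ..., k} is ['I_k.+1]; the coercion to [nat] restricts
   [delta i] to it. *)
Definition M (i k : nat) : dfa 'I_k.+1 :=
  {| dfa_state := Q;
     dfa_init := q0;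
     dfa_trans := fun q (j : 'I_k.+1) => delta i q j;
     dfa_accept := if i == 0 then [set q1] else [set q0] |}.

Definition lang_cap (k : nat) : pred (seq 'I_k.+1) :=
  [pred w | [forall i : 'I_k.+1, w \in dfa_lang (M i k)]].

Arguments lang_cap : clear implicits.

Definition is_min_length (char : finType) (L : pred (seq char)) (n : nat) :=
  (exists2 w, w \in L & size w = n) /\ (forall w, w \in L -> n <= size w).

(* Main.v *)
Require Import Defs.
From mathcomp Require Import all_boot.
From mathcomp Require Import zify.

(** For i >= 1, M_(i,k) ignores the letters > i and requires the remaining ones
    to alternate between a letter < i and the letter i.  Hence the letters i are
    as many as the letters < i, so the number of letters <= i doubles with i,
    starting from the single 0 that M_(0,k) allows: every word of the
    intersection has length exactly 2 ^ k.  Such a word is obtained from "0" by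
    inserting, for n = 1, ..., k in turn, the letter n after each letter. *)

Lemma foldl_delta_qstar i s : foldl (delta i) qstar s = qstar.
Proof. by elim: s => //= j s; rewrite /delta; case: (i == 0). Qed.

Lemma count0_run_q1 s : foldl (delta 0) q1 s = q1 -> count (leq^~ 0) s = 0.
Proof.
elim: s => //= -[|j] s IHs; rewrite [delta _ _ _]/delta /=; last exact: IHs.
by rewrite foldl_delta_qstar.
Qed.

Lemma count0_run_q0 s : foldl (delta 0) q0 s = q1 -> count (leq^~ 0) s = 1.
Proof.
case: s => //= -[|j] s; rewrite [delta _ _ _]/delta /=.
  by move/count0_run_q1->.
by rewrite foldl_delta_qstar.
Qed.

(** Each letter [<= i] that is read must be answered by a later [i.+1] before the next such letter;
    in state [q1] one answer is already owed, whence the term [q == q1]. *)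
Lemma count_run_accept i q s : foldl (delta i.+1) q s = q0 ->
  count (leq^~ i) s + (q == q1) = count_mem i.+1 s.
Proof.
elim: s q => [|j s IHs] q /=; first by move->.
move=> run_js; rewrite -(IHs _ run_js); move: run_js.
rewrite [delta _ _ _]/delta /= -(ltnS j i).
by case: q; case: (ltngtP j i.+1) => //= _; rewrite ?foldl_delta_qstar //=; lia.
Qed.

Lemma count_leqS i s :
  count (leq^~ i.+1) s = count (leq^~ i) s + count_mem i.+1 s.
Proof.
elim: s => //= j s ->; rewrite addnACA; congr (_ + _).
by rewrite -(ltnS j i); case: (ltngtP j i.+1).
Qed.

(** The ruler sequence upside down: for [0 < p < 2 ^ n], the entry at position [p] is [n] minus the
    2-adic valuation of [p]. *)
Fixpoint ruler n : seq nat :=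
  if n is m.+1 then flatten [seq [:: x; n] | x <- ruler m] else [:: 0].

Lemma size_ruler n : size (ruler n) = 2 ^ n.
Proof.
elim: n => //= n IHn; rewrite expnS -IHn.
by elim: (ruler n) => //= x s ->; rewrite mulnS.
Qed.

Lemma ruler_leq n : all (leq^~ n) (ruler n).
Proof.
elim: n => //= n; elim: (ruler n) => //= x s IHs /andP[lexn /IHs->].
by rewrite leqnn (leqW lexn).
Qed.

(** For [i > 0] the letter [m] fixes every state. For [i = 0] it fixes all but [q0], and each [m]
    comes right after some [x], while [delta 0] never enters [q0]. *)
Lemma foldl_delta_insert i m q s : i < m ->
  foldl (delta i) q (flatten [seq [:: x; m] | x <- s]) = foldl (delta i) q s.
Proof.
move=> ltim; elim: s q => //= x s IHs q; rewrite IHs; congr foldl.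
have m_neq0 : m != 0 by case: m ltim {IHs}.
have m_neqi : m != i by rewrite neq_ltn ltim orbT.
rewrite [delta _ _ m]/delta; case: eqP => [->|/eqP/negPf i_neq0].
  by rewrite /delta /= m_neq0; case: q => //; case: ifP.
by rewrite (negPf m_neqi) ltim; case: (delta i q x).
Qed.

Lemma foldl_delta_alternate n s : all (leq^~ n) s ->
  foldl (delta n.+1) q0 (flatten [seq [:: x; n.+1] | x <- s]) = q0.
Proof.
elim: s => //= x s IHs /andP[lexn /IHs].
by rewrite [delta _ q0 x]/delta /= ltnS lexn ltnNge leqW //=
  [delta _ q1 _]/delta /= eqxx.
Qed.

Lemma ruler_accepted n i : i <= n ->
  foldl (delta i) q0 (ruler n) = if i == 0 then q1 else q0.
Proof.
elim: n => [|n IHn]; first by rewrite leqn0 => /eqP->.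
rewrite leq_eqVlt => /predU1P[->|ltin].
  exact/foldl_delta_alternate/ruler_leq.
by rewrite [ruler _]/= foldl_delta_insert // IHn.
Qed.

(** Passing to words over [nat] frees the runs from the alphabet bound [k]. *)
Lemma lang_capP k (w : seq 'I_k.+1) :
  reflect (forall i, i <= k ->
             foldl (delta i) q0 (map val w) = if i == 0 then q1 else q0)
          (w \in lang_cap k).
Proof.
have run_val i q : foldl (delta i) q (map val w) = @dfa_run _ (M i k) q w.
  by elim: w q => //= j s IHs q; rewrite IHs.
have langE i : (w \in dfa_lang (M i k)) =
    (foldl (delta i) q0 (map val w) == if i == 0 then q1 else q0).
  by rewrite run_val inE /=; case: (i == 0); rewrite inE.
apply: (iffP forallP) => [Lw i leik | Lw i]; last first.
  by rewrite langE Lw // -ltnS.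
by apply/eqP; rewrite -langE; apply: (Lw (Ordinal (leik : i < k.+1))).
Qed.

Lemma size_lang_cap k (w : seq 'I_k.+1) : w \in lang_cap k -> size w = 2 ^ k.
Proof.
move/lang_capP=> Lw.
have count_pow i : i <= k -> count (leq^~ i) (map val w) = 2 ^ i.
  elim: i => [|i IHi] leik; first exact/count0_run_q0/Lw.
  rewrite count_leqS -(@count_run_accept i q0) ?Lw // addn0 addnn -mul2n expnS.
  by rewrite IHi // ltnW.
(* All letters are at most [k], so the count at [i = k] is the whole length. *)
rewrite -(count_pow k) // -(size_map val); apply/esym/eqP; rewrite -all_count.
by apply/allP=> _ /mapP[j _ ->]; rewrite -ltnS ltn_ord.
Qed.

Lemma inord_ruler_lang_cap k : map inord (ruler k) \in lang_cap k.
Proof.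
apply/lang_capP=> i leik; rewrite -map_comp -(ruler_accepted k i leik).
(* The letters of [ruler k] are at most [k], so [inord] never falls back on its default value. *)
congr foldl; rewrite -[RHS]map_id; apply/eq_in_map=> x /(allP (ruler_leq k)).
by rewrite -ltnS => ltxk; apply: inordK ltxk.
Qed.

Theorem theoremB1 (k : nat) :
  (exists w : seq 'I_k.+1, w \in lang_cap k) /\
  is_min_length (lang_cap k) (2 ^ k).
Proof.
have Lw := inord_ruler_lang_cap k.
split; first by exists (map inord (ruler k)).
split; first by exists (map inord (ruler k)); rewrite // size_map size_ruler.
by move=> w /size_lang_cap->.
Qed.
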